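(* Let $k$ be a fixed positive integer. For every $\varepsilon>0$ there exists a constant $c=c(k,\varepsilon)>0$ such that for every prime $p$ and every interval $I\subset\mathbb{F}_p\setminus\{0\}$, the number $J_{2k}$ of solutions of $$x_1^{-1}+\dots+x_k^{-1}=x_{k+1}^{-1}+\dots+x_{2k}^{-1}\quad\text{in }\mathbb{F}_p,\qquad x_1,\dots,x_{2k}\in I,$$ satisfies $$J_{2k}<c\left(|I|^{2k^2/(k+1)}+\frac{|I|^{2k}}{p}\right)|I|^{\varepsilon}.$$
   Context: $\mathbb{F}_p$ is the field of residue classes modulo the prime $p$; $x^{-1}$ is the inverse in $\mathbb{F}_p$. An interval $I$ in $\mathbb{F}_p$ is a non-empty set of residue classes of consecutive integers $M+1,\dots,M+N$ with $1\le N\le p$, and $|I|=N$ is its cardinality. *)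

(* Defs.v *)
From HB Require Import structures.
From mathcomp Require Import all_boot all_order all_algebra.
From mathcomp Require Import reals exp.

Set Implicit Arguments.
Unset Strict Implicit.
Unset Printing Implicit Defensive.

Import Order.TTheory GRing.Theory Num.Theory.
Local Open Scope ring_scope.

(* The integer M may be arbitrary, so an interval may wrap around 0 in 'F_p. *)
Definition Fp_interval (p : nat) (I : {set 'F_p}) : Prop :=
  exists (M : int) (N : nat),
    (1 <= N <= p)%N /\ I = [set (M + (i.+1)%:Z)%:~R | i : 'I_N].

(* x_1, ..., x_k are the values of x at lshift k i, and x_{k+1}, ..., x_{2k}
   those at rshift k i, for i : 'I_k. *)
Definition J2k (p k : nat) (I : {set 'F_p}) : nat :=
  #|[set x : {ffun 'I_(k + k) -> 'F_p} |
      [forall i, x i \in I] &&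
      (\sum_(i < k) (x (lshift k i))^-1 ==
       \sum_(i < k) (x (rshift k i))^-1)]|.

(* Main.v *)
(* For u <= U and V <= N / U, cover I by the progressions {x + u v : v < V}; by
   scaling, the energy of reciprocals of such a progression is that of the
   translate lam + {0, ..., V - 1}, lam = x / u.  Averaging over all translates,
   the nontrivial solutions cost only O(1) values of lam each, because lam is a
   root of a nonzero polynomial of degree < 2k.  Weighted Hoelder transfers this
   to I, at the price of the number of collisions x / u = x' / u', which a gcd
   sum bounds by O(N U log^2 U) when N U <= p.  The choice V ~ N^(2/(k+1)),
   U ~ N / V, or U ~ p / N, V ~ N^2 / p when the former violates N U <= p,
   gives the two terms of the bound. *)
Require Import Defs.
From HB Require Import structures.
From mathcomp Require Import all_boot all_order all_algebra.
From mathcomp Require Import all_field.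
From mathcomp Require Import ring zify.
From mathcomp Require Import reals exp.

Set Implicit Arguments.
Unset Strict Implicit.
Unset Printing Implicit Defensive.

Import Order.TTheory GRing.Theory Num.Theory.
Local Open Scope ring_scope.

(** * Weighted power means *)

(** Twice the difference of the two sides is the double sum of
    [w i * w j * ((b i - b j) * (c i - c j))]. *)
Lemma chebyshev_sum (R : numDomainType) (T : finType) (w b c : T -> R) :
  (forall i, 0 <= w i) -> (forall i j, 0 <= (b i - b j) * (c i - c j)) ->
  (\sum_i w i * b i) * (\sum_i w i * c i) <=
    (\sum_i w i) * \sum_i w i * (b i * c i).
Proof.
move=> w_ge0 mono_bc; rewrite -subr_ge0 -(pmulrn_lge0 _ (isT : 0 < 2)%N).
have -> : ((\sum_i w i) * (\sum_i w i * (b i * c i))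
      - (\sum_i w i * b i) * (\sum_i w i * c i)) *+ 2 =
    \sum_i \sum_j w i * w j * ((b i - b j) * (c i - c j)).
  have E (f g : T -> R) :
    (\sum_i f i) * (\sum_i g i) = \sum_i \sum_j f i * g j.
    by rewrite big_distrlr.
  rewrite mulr2n {1}[(\sum_i w i) * _]mulrC {1}[(\sum_i w i * b i) * _]mulrC.
  rewrite !E -!sumrB -big_split /=; apply: eq_bigr => i _.
  rewrite -!sumrB -big_split /=; apply: eq_bigr => j _; ring.
by apply: sumr_ge0 => i _; apply: sumr_ge0 => j _; rewrite mulr_ge0 // mulr_ge0.
Qed.

(** Induction on the exponent: [b ^+ n.+1] and [b] are similarly ordered because [b] is nonnegative,
    so Chebyshev's inequality absorbs one more factor. *)
Lemma weighted_power_mean (R : numDomainType) (T : finType) (w b : T -> R) n :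
  (forall i, 0 <= w i) -> (forall i, 0 <= b i) ->
  (\sum_i w i * b i) ^+ n.+1 <= (\sum_i w i) ^+ n * \sum_i w i * b i ^+ n.+1.
Proof.
move=> w0 b0; elim: n => [|n IHn]; first by rewrite mul1r.
rewrite exprSr.
apply: le_trans (ler_wpM2r _ IHn) _.
  by apply: sumr_ge0 => i _; rewrite mulr_ge0.
rewrite [(\sum_i w i) ^+ n.+1]exprSr -!mulrA; apply: ler_wpM2l.
  by rewrite exprn_ge0 // sumr_ge0.
under [X in _ <= _ * X]eq_bigr do rewrite exprSr.
apply: (chebyshev_sum (b := fun i => b i ^+ n.+1) (c := b)) => // i j.
have [] := real_leP (ger0_real (b0 i)) (ger0_real (b0 j)) => h.
  by rewrite mulr_le0 // subr_le0 // lerXn2r // nnegrE.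
by rewrite mulr_ge0 // subr_ge0 ?lerXn2r ?nnegrE // ltW.
Qed.

(** * Energy of reciprocals and moments of character sums *)

(* As 0^-1 = 0, an x_i = 0 is counted with summand 0; the sets to which the
   energy is applied below omit 0. *)
Definition energy (p k : nat) (A : {set 'F_p}) : nat :=
  #|[set xy : {ffun 'I_k -> 'F_p} * {ffun 'I_k -> 'F_p} |
      [&& xy.1 \in ffun_on (mem A), xy.2 \in ffun_on (mem A) &
          \sum_i (xy.1 i)^-1 == \sum_i (xy.2 i)^-1]]|.

Section Characters.

Variable p : nat.
Let n := (Zp_trunc (pdiv p)).+2.
Variable z : algC.
Hypothesis z_prim : n.-primitive_root z.

Definition chi (a : 'F_p) : algC := z ^+ a.

Lemma chiD a b : chi (a + b) = chi a * chi b.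
Proof. by rewrite /chi -exprD; exact: (prim_expr_mod z_prim). Qed.

Lemma chi0 : chi 0 = 1. Proof. by []. Qed.

Lemma chi_sum (T : finType) (P : pred T) (f : T -> 'F_p) :
  chi (\sum_(i | P i) f i) = \prod_(i | P i) chi (f i).
Proof. exact: (big_morph chi chiD chi0). Qed.

Lemma chi1_neq1 : chi 1 != 1.
Proof.
by rewrite /chi -(prim_order_dvd z_prim).
Qed.

Lemma chi_conj a : (chi a)^* = chi (- a).
Proof.
have ze : `|z| = 1.
  apply/eqP; rewrite -(@pexpr_eq1 _ _ n) // -normrX (prim_expr_order z_prim).
  by rewrite normr1.
have ne : `|chi a| = 1 by rewrite normrX ze expr1n.
have := normCK (chi a); rewrite ne expr1n => h.
have nz : chi a != 0 by rewrite -normr_gt0 ne.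
by apply: (mulfI nz); rewrite -h -chiD subrr chi0.
Qed.

(** For [a != 0] the shift of [t] by [a^-1] multiplies the sum by [chi 1], which is not 1, so the
    sum vanishes. *)
Lemma chi_orthogonality (a : 'F_p) :
  \sum_t chi (t * a) = (#|'F_p| * (a == 0))%:R.
Proof.
case: eqP => [->|/eqP a0].
  by under eq_bigr do rewrite mulr0 chi0; rewrite muln1 sumr_const.
rewrite muln0; apply/eqP; set S := \sum_t _.
have : S = chi 1 * S.
  rewrite /S mulr_sumr (reindex_inj (addrI a^-1)) /=; apply: eq_bigr => t _.
  by rewrite mulrDl mulVf // chiD.
move/eqP; rewrite -subr_eq0 -{1}[S]mul1r -mulrBl mulf_eq0 subr_eq0 eq_sym.
by rewrite (negPf chi1_neq1).
Qed.

Definition reciprocal_sum (A : {set 'F_p}) (t : 'F_p) : algC :=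
  \sum_(a in A) chi (t * a^-1).

(** The left side expands as the [k]-th power of the sum times that of its conjugate; orthogonality
    in [t] then keeps exactly the pairs of tuples with equal sums of reciprocals. *)
Lemma moment_energy k (A : {set 'F_p}) :
  \sum_t `|reciprocal_sum A t| ^+ (2 * k) = (#|'F_p| * energy k A)%:R.
Proof.
have E t : `|reciprocal_sum A t| ^+ (2 * k) =
  \sum_(x in ffun_on (mem A)) \sum_(y in ffun_on (mem A))
     chi (t * (\sum_(i < k) (x i)^-1 - \sum_(i < k) (y i)^-1)).
  have P (e : 'F_p -> algC) : (\sum_(a in A) e a) ^+ k =
      \sum_(x in ffun_on (mem A)) \prod_(i < k) e (x i).
    rewrite -(bigA_distr_big (mem A) (fun _ : 'I_k => e)) prodr_const.
    by rewrite card_ord.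
  rewrite exprM normCK exprMn /reciprocal_sum rmorph_sum /= !P mulr_suml.
  apply: eq_bigr => x _; rewrite mulr_sumr; apply: eq_bigr => y _.
  under [X in _ * X]eq_bigr do rewrite chi_conj.
  rewrite -!chi_sum -chiD; congr chi.
  by rewrite mulrBr !mulr_sumr sumrN.
under eq_bigr do rewrite E.
rewrite exchange_big /=.
under eq_bigr do rewrite exchange_big /=.
under eq_bigr do under eq_bigr do rewrite chi_orthogonality subr_eq0.
rewrite pair_big /= -natr_sum -big_distrr /=; congr (_ * _)%:R.
rewrite /energy -sum1_card [RHS]big_mkcond [LHS]big_mkcond /=.
apply: eq_bigr => xy _; rewrite in_set.
by do 2 case: (_ \in ffun_on _) => //; case: eqP.
Qed.

End Characters.

(** * Energy under covers and dilations *)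

(* Hoelder's inequality with the weight of j equal to the multiplicity of lam j:
   the weights sum to the number of collisions, and each value of lam
   contributes only once to the sum of the G's. *)
Lemma energy_cover (p k : nat) (J : finType) (A : {set 'F_p})
    (B : J -> {set 'F_p}) (lam : J -> 'F_p) (G : 'F_p -> nat) (q : nat) :
  (0 < k)%N -> (forall j, B j \subset A) ->
  (forall a, a \in A -> #|[set j | a \in B j]| = q) ->
  (forall j, energy k (B j) <= G (lam j))%N ->
  (q ^ (2 * k) * energy k A <=
     #|[set jj : J * J | lam jj.1 == lam jj.2]| ^ (2 * k).-1 *
     \sum_(l in lam @: setT) G l)%N.
Proof.
move=> k_gt0 subB coverB leG.
have [z z_prim] := C_prim_root_exists (ltn0Sn (Zp_trunc (pdiv p)).+1).
set m := fun l => #|[set i | lam i == l]|.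
have m_gt0 j : (0 < m (lam j))%N.
  by apply/card_gt0P; exists j; rewrite inE.
pose w j : algC := (m (lam j))%:R.
have w_gt0 j : 0 < w j by rewrite ltr0n.
have sum_w : \sum_j w j = #|[set jj : J * J | lam jj.1 == lam jj.2]|%:R.
  rewrite -natr_sum -sum1_card; congr _%:R.
  rewrite [RHS]big_mkcond; under [RHS]eq_bigr do rewrite in_set.
  rewrite -(pair_bigA _ (fun i j => if lam i == lam j then 1%N else 0%N)).
  apply: eq_bigr => i _; rewrite /m -sum1_card [LHS]big_mkcond /=.
  by apply: eq_bigr => j _; rewrite inE eq_sym.
have div_ge0 j (x : algC) : 0 <= x -> 0 <= x / w j.
  by move=> x_ge0; apply: divr_ge0 => //; apply: ltW.
have pt t : q%:R ^+ (2 * k) * `|reciprocal_sum z A t| ^+ (2 * k) <=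
    (\sum_j w j) ^+ (2 * k).-1 *
      \sum_j `|reciprocal_sum z (B j) t| ^+ (2 * k) / w j.
  (* Every element of [A] lies in exactly [q] of the sets [B j], so the character sums of the [B j]
     add up to [q] times that of [A]. *)
  have -> : q%:R ^+ (2 * k) * `|reciprocal_sum z A t| ^+ (2 * k) =
      `|\sum_j reciprocal_sum z (B j) t| ^+ (2 * k).
    rewrite -exprMn; congr (_ ^+ _); rewrite -(normr_nat _ q) -normrM; congr `|_|.
    rewrite /reciprocal_sum mulr_sumr.
    under [RHS]eq_bigr do rewrite big_mkcond.
    rewrite exchange_big [LHS]big_mkcond /=; apply: eq_bigr => a _.
    rewrite -big_mkcond /=; case: ifP => [aA|/negP aA].
      rewrite big_const iter_addr_0 -[RHS]mulr_natl; congr (_%:R * _).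
      by rewrite -(coverB a aA); apply: eq_card => j; rewrite !inE.
    by rewrite big1 // => j aB; case: aA; apply: (subsetP (subB j)).
  have eq2k : (2 * k = (2 * k).-1.+1)%N by rewrite prednK // muln_gt0.
  apply: (@le_trans _ _
    ((\sum_j w j * (`|reciprocal_sum z (B j) t| / w j)) ^+ (2 * k))).
    rewrite lerXn2r ?nnegrE ?normr_ge0 //.
      by apply: sumr_ge0 => j _; apply: mulr_ge0; [exact: ltW | exact: div_ge0].
    apply: le_trans (ler_norm_sum _ _ _) _; rewrite le_eqVlt; apply/orP; left.
    by apply/eqP/eq_bigr => j _; rewrite mulrC divfK ?gt_eqF.
  rewrite {1}eq2k; apply: le_trans (weighted_power_mean _ _ _) _ => [j|j|].
  - exact: ltW.
  - exact: div_ge0.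
  rewrite -eq2k; apply: ler_wpM2l; first by rewrite exprn_ge0 // sumr_ge0 // => j _; exact: ltW.
  (* Here [w (b / w)^(2k) = b^(2k) / w^(2k-1)], which is at most [b^(2k) / w] since the multiplicity
     [w] is an integer at least 1. *)
  apply: ler_sum => j _; rewrite expr_div_n mulrCA; apply: ler_wpM2l.
    exact: exprn_ge0.
  rewrite eq2k exprS invfM mulVKf ?gt_eqF // lef_pV2 ?posrE ?exprn_gt0 //.
  rewrite -natrX ler_nat.
  have -> : ((2 * k).-1 = (2 * k).-2.+1)%N by lia.
  by rewrite expnS leq_pmulr // expn_gt0 m_gt0.
have F_gt0 : 0 < #|'F_p|%:R :> algC by rewrite ltr0n; apply/card_gt0P; exists 0.
rewrite -(ler_nat algC) -(ler_pM2l F_gt0) !natrM !natrX mulrCA -[X in _ * X <= _]natrM.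
rewrite -(moment_energy z_prim) mulr_sumr.
apply: le_trans (ler_sum _ (fun t _ => pt t)) _.
rewrite -mulr_sumr mulrCA -sum_w; apply: ler_wpM2l.
  by rewrite exprn_ge0 // sumr_ge0 // => j _; apply: ltW.
rewrite exchange_big /=.
under eq_bigr do rewrite -mulr_suml (moment_energy z_prim) natrM -mulrA.
rewrite -mulr_sumr; apply: ler_wpM2l; first exact: ltW.
apply: (@le_trans _ _ (\sum_j (G (lam j))%:R / w j)).
  apply: ler_sum => j _; apply: ler_wpM2r; first by rewrite invr_ge0 ltW.
  by rewrite ler_nat.
rewrite [X in X <= _](_ : _ = \sum_(j in setT) (G (lam j))%:R / w j); last first.
  by apply: eq_bigl => j; rewrite inE.
(* The fibre of [lam] over [l] has as many elements as the weight in the denominator, so its terms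
   add up to [G l] exactly. *)
rewrite (partition_big_imset lam) natr_sum; apply: ler_sum => l /imsetP[i _ ->].
rewrite (eq_bigr (fun _ => (G (lam i))%:R / w i)); last first.
  by move=> j /andP[_ /eqP e]; rewrite /w e.
rewrite big_const iter_addr_0 -[X in X <= _]mulr_natr (_ : #|_| = m (lam i)).
  by rewrite divfK ?gt_eqF ?w_gt0.
by apply: eq_card => j; rewrite [LHS]unfold_in /= !inE.
Qed.

(** Dilation by [c] divides every reciprocal by [c], so it maps solutions injectively to
    solutions. *)
Lemma energy_scale (p k : nat) (c : 'F_p) (A B : {set 'F_p}) :
  c != 0 -> (forall a, a \in A -> c * a \in B) ->
  (energy k A <= energy k B)%N.
Proof.
move=> c_neq0 scaleAB.
pose sc (x : {ffun 'I_k -> 'F_p}) := [ffun i => c * x i].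
have sc_inj : injective sc.
  move=> x y /ffunP e; apply/ffunP => i.
  by have := e i; rewrite !ffunE => /(mulfI c_neq0).
rewrite /energy -(card_imset _ (f := fun xy => (sc xy.1, sc xy.2))); last first.
  by move=> [x y] [x' y'] /= [/sc_inj-> /sc_inj->].
apply/subset_leq_card/subsetP => _ /imsetP[[x y] + ->].
rewrite !inE /= => /and3P[/ffun_onP xA /ffun_onP yA /eqP e].
apply/and3P; split; last first.
  have V z : \sum_i (sc z i)^-1 = c^-1 * \sum_i (z i)^-1.
    by rewrite mulr_sumr; apply: eq_bigr => i _; rewrite ffunE invfM.
  by rewrite !V e.
all: by apply/ffun_onP => i; rewrite ffunE scaleAB.
Qed.

(** * Energy averaged over translates *)

(* The x_i may repeat, so poles are grouped by value; the pole at x_i0 has the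
   multiplicity #{i | x_i = x_i0} <= k < p as residue, so the numerator of the
   difference of the two sides is a nonzero polynomial. *)
Lemma card_roots_reciprocals (F : finFieldType) (k : nat)
    (x y : {ffun 'I_k -> F}) (i0 : 'I_k) :
  (forall m, (0 < m <= k)%N -> m%:R != 0 :> F) ->
  (forall j, y j != x i0) ->
  (#|[set l : F | [forall i, (l + x i != 0)%R && (l + y i != 0)%R] &&
       (\sum_i (l + x i)^-1 == \sum_i (l + y i)^-1)%R]| <= 2 * k)%N.
Proof.
move=> natr_neq0 y_neq.
pose W := (x @: setT) :|: (y @: setT).
have cardW : (#|W| <= 2 * k)%N.
  rewrite mul2n -addnn (leq_trans (leq_card_setU _ _)) //.
  by apply: leq_add; rewrite (leq_trans (leq_imset_card _ _)) // cardsT card_ord.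
pose mult (z : {ffun 'I_k -> F}) v : F := #|[set i | z i == v]|%:R.
pose c v := mult x v - mult y v.
(* [Q] is the difference of the two sums times their common denominator, with one linear factor for
   each distinct value in [W]. *)
pose Q := \sum_(v in W) c v *: \prod_(w in W :\ v) ('X + w%:P).
have regroup (z : {ffun 'I_k -> F}) l : (forall i, z i \in W) ->
    \sum_i (l + z i)^-1 = \sum_(v in W) mult z v / (l + v).
  move=> zW; rewrite (partition_big z (mem W)) //=; apply: eq_bigr => v _.
  rewrite (eq_bigr (fun _ => (l + v)^-1)) => [|i /eqP->//].
  rewrite big_const iter_addr_0 -[LHS]mulr_natl; congr (_%:R * _).
  by apply: eq_card => i; rewrite [LHS]unfold_in !inE.
have xW i : x i \in W by rewrite inE imset_f.
have yW i : y i \in W by rewrite inE orbC imset_f.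
have Q_neq0 : Q != 0.
  (* At [- x i0] only the term of [v = x i0] survives: all others contain the factor
     ['X + (x i0)%:P]. *)
  apply/eqP => /(congr1 (horner^~ (- x i0))); rewrite horner0 => /eqP.
  rewrite horner_sum (bigD1 (x i0) (xW i0)) /=.
  rewrite [X in _ + X]big1 ?addr0 => [|v /andP[vW v_neq]].
    rewrite hornerZ mulf_eq0 /c => /orP[|].
      rewrite [mult y _](_ : _ = 0) ?subr0; last first.
        rewrite /mult; apply/eqP; rewrite (_ : #|_| = 0)%N //.
        by apply: eq_card0 => j; rewrite inE (negPf (y_neq j)).
      apply/negP/natr_neq0; apply/andP; split.
        by apply/card_gt0P; exists i0; rewrite inE.
      by rewrite -[X in (_ <= X)%N](card_ord k) max_card.
    rewrite horner_prod => /prodf_eq0[w]; rewrite !inE => /andP[w_neq _].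
    by rewrite !hornerE addrC subr_eq0 (negPf w_neq).
  rewrite hornerZ horner_prod (bigD1 (x i0)) /=; last first.
    by rewrite in_setD1 eq_sym v_neq xW.
  by rewrite hornerD hornerX hornerC addNr; apply/eqP; rewrite !mulf_eq0 eqxx orbT.
have sizeQ : (size Q <= #|W|)%N.
  apply: (leq_trans (size_sum _ _ _)); apply/bigmax_leqP => v vW.
  rewrite (leq_trans (size_scale_leq _ _)) //.
  have -> : \prod_(w in W :\ v) ('X + w%:P) =
      \prod_(w <- enum (W :\ v)) ('X - (- w)%:P).
    by rewrite big_enum; apply: eq_bigr => w _; rewrite polyCN opprK.
  by rewrite size_prod_XsubC -cardE [leqRHS](cardsD1 v) vW add1n.
set S := [set l | _].
rewrite (leq_trans _ cardW) // (leq_trans _ sizeQ) // cardE ltnW //.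
apply: max_poly_roots => //; last exact: enum_uniq.
apply/allP => l; rewrite mem_enum inE => /andP[/forallP nz /eqP eq_xy].
have nzW v : v \in W -> l + v != 0.
  rewrite inE => /orP[] /imsetP[i _ ->]; by have /andP[] := nz i.
rewrite rootE horner_sum.
have -> : \sum_(v in W) (c v *: \prod_(w in W :\ v) ('X + w%:P)).[l] =
    (\prod_(w in W) (l + w)) * \sum_(v in W) c v / (l + v).
  rewrite mulr_sumr; apply: eq_bigr => v vW.
  rewrite hornerZ horner_prod [\prod_(w in W) _](big_setD1 v) //= mulrCA.
  rewrite [(l + v) * _]mulrC mulfK ?nzW //; congr (_ * _).
  by apply: eq_bigr => w _; rewrite !hornerE.
under [X in _ * X]eq_bigr do rewrite mulrBl.
by rewrite sumrB -!regroup // eq_xy subrr mulr0.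
Qed.

(** After exchanging the sums one counts, for each pair [(x, y)] of tuples from [D], the shifts [l]
    that make it a solution. If every entry of [x] occurs in [y], all of [L] is allowed for;
    otherwise [x] has a pole that [y] lacks, and at most [2k] shifts remain. *)
Lemma sum_energy_translates (p k : nat) (D L : {set 'F_p}) :
  (forall m, (0 < m <= k)%N -> m%:R != 0 :> 'F_p) ->
  (\sum_(l in L) energy k ([set (l + d)%R | d in D] :\ 0%R) <=
     #|L| * (k ^ k * #|D| ^ k) + 2 * k * #|D| ^ (2 * k))%N.
Proof.
move=> natr_neq0.
pose sol (l : 'F_p) (xy : {ffun 'I_k -> 'F_p} * {ffun 'I_k -> 'F_p}) :=
  [forall i, (l + xy.1 i != 0) && (l + xy.2 i != 0)] &&
  (\sum_i (l + xy.1 i)^-1 == \sum_i (l + xy.2 i)^-1).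
pose triv (xy : {ffun 'I_k -> 'F_p} * {ffun 'I_k -> 'F_p}) :=
  [forall i, exists j, xy.2 j == xy.1 i].
pose DD := setX [set x | x \in @ffun_on_mem 'I_k _ (mem D)]
                [set y | y \in @ffun_on_mem 'I_k _ (mem D)].
have cardDk : #|[set x | x \in @ffun_on_mem 'I_k _ (mem D)]| = (#|D| ^ k)%N.
  by rewrite cardsE card_ffun_on card_ord.
have en_le l : (energy k ([set (l + d)%R | d in D] :\ 0%R) <=
    \sum_(xy in DD) sol l xy)%N.
  pose tr (x : {ffun 'I_k -> 'F_p}) := [ffun i => x i - l].
  have tr_inj : injective tr.
    move=> x y /ffunP e; apply/ffunP => i.
    by have := e i; rewrite !ffunE => /addIr.
  rewrite -big_mkcondr /= sum1_card /energy.
  rewrite -(card_imset _ (f := fun xy => (tr xy.1, tr xy.2))); last first.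
    by move=> [x y] [x' y'] /= [/tr_inj-> /tr_inj->].
  apply/subset_leq_card/subsetP => _ /imsetP[[x y] + ->].
  rewrite inE /= => /and3P[/ffun_onP xA /ffun_onP yA /eqP e].
  have inD (z : {ffun 'I_k -> 'F_p}) i :
      z i \in [set l + d | d in D] :\ 0 -> (z i != 0) && (tr z i \in D).
    by rewrite !inE ffunE => /andP[-> /imsetP[d dD ->]]; rewrite addrC addKr.
  have trK (z : {ffun 'I_k -> 'F_p}) i : l + tr z i = z i.
    by rewrite ffunE addrC subrK.
  rewrite unfold_in /= !inE; apply/andP; split.
    apply/andP; split; apply/ffun_onP => i /=.
      by have /andP[] := inD _ _ (xA i).
    by have /andP[] := inD _ _ (yA i).
  rewrite /sol /=; apply/andP; split.
    apply/forallP => i; rewrite !trK.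
    by have /andP[-> _] := inD _ _ (xA i); have /andP[-> _] := inD _ _ (yA i).
  by under eq_bigr do rewrite trK; under [X in _ == X]eq_bigr do rewrite trK; rewrite e.
apply: leq_trans (leq_sum _ (fun l _ => en_le l)) _.
rewrite exchange_big /= (bigID triv) /=; apply: leq_add.
  apply: (@leq_trans (\sum_(xy in DD | triv xy) #|L|)%N).
    apply: leq_sum => xy _; rewrite -sum1_card; apply: leq_sum => l _.
    exact: leq_b1.
  pose T := [set xy in DD | triv xy].
  rewrite (eq_bigl (fun xy => xy \in T)) => [|xy]; last by rewrite [RHS]in_set.
  rewrite sum_nat_const mulnC leq_mul2l; apply/orP; right.
  (* [wit] sends each [i] to some [j] with [y j = x i], so a trivial pair is recovered from [wit]
     and [y]: [k^k] maps times [#|D|^k] tuples. The default [i] is never reached on trivial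
     pairs. *)
  pose wit (xy : {ffun 'I_k -> 'F_p} * {ffun 'I_k -> 'F_p}) : {ffun 'I_k -> 'I_k} :=
    [ffun i => odflt i [pick j | xy.2 j == xy.1 i]].
  have witP xy i : triv xy -> xy.2 (wit xy i) = xy.1 i.
    move=> /forallP/(_ i)/existsP[j hj]; rewrite ffunE.
    by case: pickP => [j' /eqP//|/(_ j)]; rewrite hj.
  rewrite -cardDk; have -> : (k ^ k)%N = #|{: {ffun 'I_k -> 'I_k}}|.
    by rewrite card_ffun card_ord.
  rewrite -cardsT -cardsX -(card_in_imset (f := fun xy => (wit xy, xy.2))).
    apply/subset_leq_card/subsetP => _ /imsetP[[x y] + ->].
    rewrite in_set => /andP[xyD _].
    by move: xyD; rewrite !in_setX !in_set => /andP[].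
  move=> [x y] [x' y']; rewrite !in_set => /andP[_ t] /andP[_ t'] /= [ew ey].
  rewrite ey; congr (_, _); apply/ffunP => i.
  by rewrite -(witP (x, y)) // -(witP (x', y')) // ew /= ey.
apply: (@leq_trans (\sum_(xy in DD) 2 * k)%N); last first.
  by rewrite sum_nat_const cardsX cardDk -expnD addnn -mul2n mulnC.
rewrite [leqRHS](bigID triv) /=; apply: leq_trans (leq_addl _ _).
apply: leq_sum => xy /andP[_]; rewrite negb_forall => /existsP[i0].
rewrite negb_exists => /forallP y_neq.
apply: leq_trans (card_roots_reciprocals natr_neq0 y_neq).
rewrite -sum1_card big_mkcond [leqRHS]big_mkcond /=; apply: leq_sum => l _.
by rewrite inE /sol; case: (l \in L) => //; case: (_ && _).
Qed.

(** * Counting solutions of the cross-multiplied congruence *)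

(** The equation gives [(t - s) u' = (t' - s') u], so [u / gcd] divides [t - s]; two numbers
    congruent modulo [u / gcd] with the same quotient are equal. *)
Lemma eq_of_cross_congruence (u u' s t s' t' : nat) :
  (0 < u)%N -> (s * u' + t' * u = t * u' + s' * u)%N ->
  (s %/ (u %/ gcdn u u') = t %/ (u %/ gcdn u u'))%N -> s = t.
Proof.
move=> u_gt0; wlog le_st : s t s' t' / (s <= t)%N => [H e h|].
  have [le_st|/ltnW le_ts] := leqP s t; first exact: (H _ _ _ _ le_st e h).
  by apply/esym/(H _ _ _ _ le_ts (esym e) (esym h)).
move=> e h; set g := gcdn u u' in h *.
have g_gt0 : (0 < g)%N by rewrite gcdn_gt0 u_gt0.
have eu : u = (u %/ g * g)%N by rewrite divnK ?dvdn_gcdl.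
have eu' : u' = (u' %/ g * g)%N by rewrite divnK ?dvdn_gcdr.
have cop : coprime (u %/ g) (u' %/ g).
  by rewrite /coprime -(eqn_pmul2r g_gt0) muln_gcdl -eu -eu' mul1n.
have dvd_u : (u %| (t - s) * u')%N.
  apply/dvdnP; exists (t' - s')%N; rewrite !mulnBl; clear -e; lia.
move: dvd_u; rewrite {1}eu {1}eu' mulnA dvdn_pmul2r // Gauss_dvdl //.
rewrite -eqn_mod_dvd // => /eqP e'.
by rewrite (divn_eq s (u %/ g)) (divn_eq t (u %/ g)) h e'.
Qed.

(** The integer tested lies in an interval of length [2SU], which limits the multiples of [p] it can
    equal. Once that multiple is fixed, the quotient of [s] by [u / gcd] determines [s], and then
    [s']. *)
Lemma card_cross_congruence (p U S u u' : nat) (L : int) :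
  (0 < p)%N -> (0 < u <= U)%N -> (0 < u' <= U)%N ->
  (#|[set ss : 'I_S * 'I_S |
       (p %| ((L + ss.1%:Z) * u' - (L + ss.2%:Z) * u)%R)%Z]| <=
     (2 * S * U %/ p).+2 * (S %/ (u %/ gcdn u u')).+1)%N.
Proof.
move=> p_gt0 /andP[u_gt0 uU] /andP[u'_gt0 u'U].
set E := [set ss | _]; set d := (u %/ gcdn u u')%N.
set a := (2 * S * U %/ p).+1; set b := (S %/ d)%N.
pose W (ss : 'I_S * 'I_S) : int := (L + ss.1%:Z) * u' - (L + ss.2%:Z) * u.
(* [q0] is the quotient by [p] of a lower bound for [W], so on [E] the absolute value in [q] is that
   of a nonnegative number. *)
pose q0 : int := ((L * (u'%:Z - u%:Z) - (S * U)%N%:Z) %/ p)%Z.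
pose q ss : nat := `|(W ss %/ p)%Z - q0|%N.
have qP ss : ss \in E -> (q ss <= a)%N /\ W ss = (q0 + (q ss)%:Z) * p%:Z.
  case: ss => s s'; rewrite inE => /dvdzP[w ew]; rewrite /= in ew.
  have p_neq0 : p%:Z != 0 by rewrite eqz_nat -lt0n.
  have e1 : W (s, s') = w * p%:Z by [].
  rewrite /q e1 mulzK //.
  have e2 := divz_eq (L * (u'%:Z - u%:Z) - (S * U)%N%:Z) p.
  have r_ge0 := modz_ge0 (L * (u'%:Z - u%:Z) - (S * U)%N%:Z) p_neq0.
  have r_lt : ((L * (u'%:Z - u%:Z) - (S * U)%N%:Z) %% p%:Z)%Z < p%:Z.
    by apply: ltz_pmod.
  rewrite -/q0 in e2.
  move: r_ge0 r_lt e2; set r := modz _ _; move=> r_ge0 r_lt e2.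
  have s'u : (s' * u <= S * U)%N by rewrite leq_mul // ltnW.
  have su' : (s * u' <= S * U)%N by rewrite leq_mul // ltnW.
  have hw : (w - q0) * p%:Z = (s * u')%N%:Z - (s' * u)%N%:Z + (S * U)%N%:Z + r.
    rewrite mulrBl -ew; rewrite /= in e2 *.
    have -> : q0 * p%:Z = (L * (u'%:Z - u%:Z) - (S * U)%N%:Z) - r.
      by rewrite e2 addrK.
    rewrite !PoszM; ring.
  have ge0 : 0 <= w - q0.
    rewrite -(pmulr_lge0 _ (_ : 0 < p%:Z)) // hw; clear -s'u su' r_ge0; lia.
  rewrite gez0_abs //; split; last by rewrite [q0 + _]addrCA subrr addr0.
  rewrite -ltnS -ltz_nat gez0_abs // -(ltr_pM2r (_ : 0 < p%:Z)) // hw.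
  have := ltn_ceil (2 * S * U) p_gt0; rewrite -/a => h.
  apply: (@lt_le_trans _ _ (2 * S * U + p)%N%:Z); first by clear -s'u su' r_lt; lia.
  rewrite -PoszM lez_nat -/a mulSn addnC leq_add2l; exact: ltnW.
pose f (ss : 'I_S * 'I_S) : 'I_a.+1 * 'I_b.+1 := (inord (q ss), inord (ss.1 %/ d)).
have f_inj : {in E &, injective f}.
  move=> ss tt ssE ttE.
  have [qs es] := qP _ ssE; have [qt et] := qP _ ttE.
  case: ss tt {ssE ttE} qs es qt et => [s s'] [t t'] qs es qt et.
  move=> /= [/(congr1 val) /= eq1 /(congr1 val) /= eq2].
  move: eq1 eq2; rewrite !inordK ?ltnS ?leq_div2r ?(ltnW (ltn_ord _)) // => eq1 eq2.
  have eW : W (s, s') = W (t, t') by rewrite es et eq1.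
  have e : (s * u' + t' * u = t * u' + s' * u)%N.
    apply/eqP; rewrite -eqz_nat !PoszD !PoszM -subr_eq0.
    rewrite (_ : _ - _ = W (s, s') - W (t, t')); last by rewrite /W /=; ring.
    by rewrite eW subrr.
  have st := eq_of_cross_congruence u_gt0 e eq2.
  have st' : t' = s' :> nat.
    by move: e; rewrite st => /addnI/eqP; rewrite eqn_pmul2r // => /eqP.
  by congr (_, _); apply: val_inj.
rewrite -(card_in_imset f_inj) (leq_trans (max_card _)) //.
by rewrite card_prod !card_ord.
Qed.

(** * Harmonic and gcd sums *)

Definition harmonic (R : numFieldType) (n : nat) : R :=
  \sum_(1 <= d < n.+1) d%:R^-1.

Lemma le_harmonic (R : numFieldType) m n :
  (m <= n)%N -> harmonic R m <= harmonic R n.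
Proof.
move=> mn; rewrite /harmonic [leRHS](big_cat_nat (n := m.+1)) //= lerDl.
by apply: sumr_ge0 => d _; rewrite invr_ge0.
Qed.

Lemma harmonic_ge1 (R : numFieldType) n : (0 < n)%N -> 1 <= harmonic R n.
Proof.
move=> n_gt0; apply: le_trans (le_harmonic R n_gt0).
by rewrite /harmonic big_nat1 invr1.
Qed.

Lemma sum_multiples (R : nmodType) (d n : nat) (f : nat -> R) : (0 < d)%N ->
  \sum_(1 <= u < n.+1 | (d %| u)%N) f u = \sum_(1 <= a < (n %/ d).+1) f (d * a)%N.
Proof.
move=> d_gt0; elim: n => [|n IHn]; first by rewrite div0n !big_nil.
rewrite big_mkcond big_nat_recr //= -big_mkcond /= IHn divnS //.
case: (boolP (d %| n.+1)%N) => dvd; last by rewrite addr0 add0n.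
rewrite add1n [RHS]big_nat_recr //=; congr (_ + f _).
have := divnS n d_gt0; rewrite dvd add1n => <-.
by rewrite mulnC divnK.
Qed.

(** [gcdn u v] is at most the sum of the common divisors [d] of [u] and [v]. For fixed [d] there are
    at most [n / d] multiples [v], and the terms [d / u] over the multiples [u] sum to at most
    [harmonic R n]. *)
Lemma sum_gcd_div (R : realFieldType) (n : nat) :
  \sum_(1 <= u < n.+1) \sum_(1 <= v < n.+1) (gcdn u v)%:R / u%:R
    <= n%:R * harmonic R n ^+ 2.
Proof.
pose T d u v : R := if (d %| u)%N then if (d %| v)%N then d%:R / u%:R else 0 else 0.
have T_ge0 d u v : 0 <= T d u v.
  by rewrite /T; case: ifP => // _; case: ifP => // _; rewrite divr_ge0.
apply: (@le_trans _ _
  (\sum_(1 <= u < n.+1) \sum_(1 <= v < n.+1) \sum_(1 <= d < n.+1) T d u v)).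
  rewrite !big_nat; apply: ler_sum => u /andP[u_gt0 un].
  rewrite !big_nat; apply: ler_sum => v _.
  have g_in : (gcdn u v) \in index_iota 1 n.+1.
    rewrite mem_index_iota gcdn_gt0 u_gt0 /= (leq_ltn_trans _ un) //.
    by rewrite dvdn_leq // dvdn_gcdl.
  rewrite (bigD1_seq _ g_in) ?iota_uniq //= {1}/T dvdn_gcdl dvdn_gcdr lerDl.
  exact: sumr_ge0.
under eq_bigr do rewrite exchange_big /=.
rewrite exchange_big /=.
have H_ge0 : 0 <= harmonic R n by apply: sumr_ge0 => d _; rewrite invr_ge0.
have -> : n%:R * harmonic R n ^+ 2 =
    \sum_(1 <= d < n.+1) harmonic R n * (n%:R / d%:R).
  by rewrite -mulr_sumr -mulr_sumr expr2 mulrCA.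
rewrite !big_nat; apply: ler_sum => d /andP[d_gt0 _].
have d_neq0 : d%:R != 0 :> R by rewrite pnatr_eq0 -lt0n.
apply: (@le_trans _ _
  (\sum_(1 <= u < n.+1 | (d %| u)%N) d%:R / u%:R * (n %/ d)%:R)).
  rewrite [leRHS]big_mkcond /=; apply: ler_sum => u _.
  rewrite /T; case: ifP => _; last by rewrite big1.
  rewrite -big_mkcond sum_multiples // sumr_const_nat subn1 /=.
  by rewrite -[X in X <= _]mulr_natr.
rewrite -mulr_suml sum_multiples //; apply: ler_pM => //.
- by apply: sumr_ge0 => u _; rewrite divr_ge0.
- apply: le_trans (le_harmonic R (leq_div n d)).
  by apply: ler_sum => a _; rewrite natrM invfM mulrA divff ?mul1r.
by rewrite ler_pdivlMr ?ltr0n // -natrM ler_nat leq_divM.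
Qed.

(** * Collisions of slopes *)

(** The ratio of start to difference of a progression that starts at [L + j.2]; the differences
    [j.1 + 1] run from 1 to [U]. *)
Definition slope (p U S : nat) (L : int) (j : 'I_U * 'I_S) : 'F_p :=
  (L + j.2%:Z)%:~R / j.1.+1%:R.

Lemma natr_Fp_neq0 (p m : nat) : prime p -> (0 < m < p)%N -> m%:R != 0 :> 'F_p.
Proof.
move=> p_pr /andP[m_gt0 mp]; rewrite -(dvdn_pcharf (pchar_Fp p_pr)).
by rewrite gtnNdvd.
Qed.

Lemma card_slope_collisions (R : realFieldType) (p N U : nat) (L : int) :
  prime p -> (0 < U)%N -> (U <= N)%N -> (N < p)%N -> (N * U <= p)%N ->
  #|[set jj : ('I_U * 'I_(2 * N).+1) * ('I_U * 'I_(2 * N).+1) |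
      slope p L jj.1 == slope p L jj.2]|%:R
    <= 32%:R * (N * U)%:R * harmonic R U ^+ 2 :> R.
Proof.
move=> p_pr U_gt0 UN Np NUp; set S := (2 * N).+1.
have p_gt0 := prime_gt0 p_pr.
have S_le : (S <= 3 * N)%N by rewrite /S; lia.
set Z := [set jj | _].
(* Since [2SU <= 6NU <= 6p], at most [6 + 2 = 8] multiples of [p] are admissible. *)
have cardZ : (#|Z| <= \sum_(i < U) \sum_(i' < U)
    8 * (S %/ (i.+1 %/ gcdn i.+1 i'.+1)).+1)%N.
  rewrite -sum1_card (partition_big (fun jj => (jj.1.1, jj.2.1)) predT) //=.
  rewrite pair_big /=; apply: leq_sum => -[i i'] _ /=.
  have iU : (0 < i.+1 <= U)%N by rewrite /= ltn_ord.
  have i'U : (0 < i'.+1 <= U)%N by rewrite /= ltn_ord.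
  apply: leq_trans (leq_trans (card_cross_congruence S L p_gt0 iU i'U) _); last first.
    rewrite leq_mul2r; apply/orP; right.
    have : (2 * S * U %/ p <= 6)%N.
      rewrite -ltnS ltn_divLR //; apply: (@leq_ltn_trans (6 * (N * U))).
        by rewrite mulnA leq_mul2r; apply/orP; right; lia.
      lia.
    by lia.
  rewrite sum1dep_card.
  pose f (jj : ('I_U * 'I_S) * ('I_U * 'I_S)) := (jj.1.2, jj.2.2).
  rewrite -(card_in_imset (f := f)).
    apply/subset_leq_card/subsetP => _ /imsetP[[[u s] [u' s']] + ->].
    rewrite !inE /= => /andP[/eqP e /eqP[eu eu']].
    rewrite (dvdz_pcharf (pchar_Fp p_pr)) rmorphB !rmorphM /=.
    move: e; rewrite /slope /= eu eu' => /eqP.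
    rewrite eqr_div ?natr_Fp_neq0 //.
      by rewrite -subr_eq0.
    - exact: leq_ltn_trans (ltn_ord i) (leq_ltn_trans UN Np).
    - exact: leq_ltn_trans (ltn_ord i') (leq_ltn_trans UN Np).
  move=> [[u s] [u' s']] [[v t] [v' t']].
  by rewrite !inE /= => /andP[_ /eqP[-> ->]] /andP[_ /eqP[-> ->]] [-> ->].
have H_ge1 := harmonic_ge1 R U_gt0.
have H2_ge1 : 1 <= harmonic R U ^+ 2 by rewrite expr_ge1 // (le_trans ler01).
apply: (@le_trans _ _ (\sum_(1 <= u < U.+1) \sum_(1 <= v < U.+1)
    8%:R * (S%:R * ((gcdn u v)%:R / u%:R) + 1 : R))).
  rewrite big_add1 big_mkord; under eq_bigr do rewrite big_add1 big_mkord.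
  rewrite (le_trans (_ : _ <= (\sum_(i < U) \sum_(i' < U)
    8 * (S %/ (i.+1 %/ gcdn i.+1 i'.+1)).+1)%N%:R)) ?ler_nat //.
  rewrite natr_sum; apply: ler_sum => i _; rewrite natr_sum; apply: ler_sum => i' _.
  rewrite natrM ler_pM2l ?ltr0n // -natr1 lerD2r.
  set g := gcdn _ _; set d := (_ %/ g)%N.
  have g_gt0 : (0 < g)%N by rewrite gcdn_gt0.
  have ei : (d * g = i.+1)%N by rewrite divnK // dvdn_gcdl.
  have d_gt0 : (0 < d)%N by rewrite lt0n; apply/eqP => d0; rewrite d0 in ei.
  rewrite -ei natrM invfM [g%:R * _]mulrCA divff ?pnatr_eq0 -?lt0n // mulr1.
  by rewrite ler_pdivlMr ?ltr0n // -natrM ler_nat leq_divM.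
have -> : \sum_(1 <= u < U.+1) \sum_(1 <= v < U.+1)
    8%:R * (S%:R * ((gcdn u v)%:R / u%:R) + 1 : R) =
  8%:R * (S%:R * (\sum_(1 <= u < U.+1) \sum_(1 <= v < U.+1)
    (gcdn u v)%:R / u%:R) + (U * U)%:R).
  under eq_bigr do rewrite -mulr_sumr big_split /= -mulr_sumr.
  rewrite -mulr_sumr big_split /= -mulr_sumr; congr (_ * (_ + _)).
  by rewrite !sumr_const_nat subn1 /= natrM mulr_natr.
(* The constant is [32 = 8 (3 + 1)], from [S <= 3N] and [U U <= N U]. *)
have -> : 32%:R * (N * U)%:R * harmonic R U ^+ 2 =
    8%:R * ((3 * N)%:R * (U%:R * harmonic R U ^+ 2) +
            (N * U)%:R * harmonic R U ^+ 2) by rewrite !natrM; ring.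
rewrite ler_pM2l ?ltr0n //; apply: lerD.
  apply: ler_pM => //; last exact: sum_gcd_div.
    by apply: sumr_ge0 => u _; apply: sumr_ge0 => v _; rewrite divr_ge0.
  by rewrite ler_nat.
apply: (@le_trans _ _ (N * U)%:R); first by rewrite ler_nat leq_mul2r UN orbT.
by rewrite ler_peMr.
Qed.

(** * Energy of an interval *)

Lemma J2k_le_energy (p k : nat) (I : {set 'F_p}) : (J2k k I <= energy k I)%N.
Proof.
pose f (x : {ffun 'I_(k + k) -> 'F_p}) :=
  ([ffun i : 'I_k => x (lshift k i)], [ffun i : 'I_k => x (rshift k i)]).
have f_inj : injective f.
  move=> x y [/ffunP el /ffunP er]; apply/ffunP => i.
  by case: (split_ordP i) => j ->; [have := el j | have := er j]; rewrite !ffunE.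
rewrite /J2k -(card_imset _ f_inj).
apply/subset_leq_card/subsetP => _ /imsetP[x + ->].
rewrite !inE /= => /andP[/forallP xI /eqP e]; apply/and3P; split.
- by apply/ffun_onP => i; rewrite ffunE; exact: xI.
- by apply/ffun_onP => i; rewrite ffunE; exact: xI.
- under eq_bigr do rewrite ffunE; under [X in _ == X]eq_bigr do rewrite ffunE.
  by rewrite e.
Qed.

Lemma intr_Fp_inj (p : nat) (M : int) (N : nat) : prime p -> (N <= p)%N ->
  injective (fun i : 'I_N => (M + i.+1%:Z)%:~R : 'F_p).
Proof.
move=> p_pr Np i j /eqP; rewrite -subr_eq0 -rmorphB.
rewrite -(dvdz_pcharf (pchar_Fp p_pr)) => dvd; apply/val_inj/eqP => /=.
have : (p %| `|i - j|)%N.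
  move: dvd; rewrite dvdzE /=; congr (_ %| `|_|)%N; lia.
rewrite -eqz_nat -subr_eq0 -absz_eq0.
apply: contraLR => nz; rewrite gtnNdvd ?lt0n //.
have := ltn_ord i; have := ltn_ord j; lia.
Qed.

(** The cover lemma is applied with multiplicity [U V]; the collision bound supplies its first
    factor, the average over translates its second. *)
Lemma energy_interval_bound (R : realFieldType) (p k N U V : nat) (M : int)
    (I : {set 'F_p}) :
  prime p -> (0 < k < p)%N -> (0 < U)%N -> (0 < V)%N -> (U * V <= N)%N ->
  (N < p)%N -> (N * U <= p)%N ->
  I = [set (M + (i.+1)%:Z)%:~R | i : 'I_N] -> 0 \notin I ->
  ((U * V) ^ (2 * k) * energy k I)%:R <=
    (32%:R * (N * U)%:R * harmonic R U ^+ 2) ^+ (2 * k).-1 *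
    (3 * (N * U) * (k ^ k * V ^ k) + 2 * k * V ^ (2 * k))%:R :> R.
Proof.
move=> p_pr /andP[k_gt0 kp] U_gt0 V_gt0 UVN Np NUp defI I0.
have UN : (U <= N)%N by apply: leq_trans UVN; rewrite leq_pmulr.
(* Starting points run over an interval that begins U * V before I, so that each
   element of I lies in exactly one progression for each difference u and each
   position v. *)
pose L : int := M + 1 - (U * V)%N%:Z.
pose S := (2 * N).+1.
pose D : {set 'F_p} := [set (v : nat)%:R | v : 'I_V].
have cardD : (#|D| <= V)%N by rewrite (leq_trans (leq_imset_card _ _)) ?card_ord.
(* [B j] is the part inside [I] of the progression [L + s + u v], with [s = j.2] and [u = j.1 + 1];
   adding [U V] to [n] expresses [M + n + 1 = L + s + u v] without subtraction. *)
pose B (j : 'I_U * 'I_S) := [set a in I |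
  [exists n : 'I_N, exists v : 'I_V,
    (a == (M + n.+1%:Z)%:~R) && (n + U * V == j.2 + j.1.+1 * v)%N]].
have subB j : B j \subset I by apply/subsetP => a; rewrite inE => /andP[].
have coverB a : a \in I -> #|[set j | a \in B j]| = (U * V)%N.
  move=> aI; move: (aI); rewrite defI => /imsetP[n _ ea].
  have in_range (i : 'I_U) (v : 'I_V) :
      (i.+1 * v <= n + U * V)%N /\ (n + U * V - i.+1 * v < S)%N.
    have h : (i.+1 * v <= U * V)%N by rewrite leq_mul // ltnW.
    by have := ltn_ord n; rewrite /S; lia.
  pose f (iv : 'I_U * 'I_V) : 'I_U * 'I_S :=
    (iv.1, inord (n + U * V - iv.1.+1 * iv.2)).
  have f_inj : injective f.
    move=> [i v] [i' v'] [ei /(congr1 val)]; rewrite -{}ei {i'} /=.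
    have [r1 s1] := in_range i v; have [r2 s2] := in_range i v'.
    rewrite !inordK // => e.
    have /eqP : (i.+1 * v = i.+1 * v')%N by lia.
    by rewrite eqn_pmul2l // => /eqP/val_inj->.
  rewrite (_ : [set j | a \in B j] = f @: setT).
    by rewrite card_imset // cardsT card_prod !card_ord.
  apply/setP => -[i s]; rewrite !inE aI; apply/idP/imsetP => /=.
    move=> /existsP[n' /existsP[v /andP[/eqP ea' /eqP e]]].
    have en : n' = n.
      by apply: (@intr_Fp_inj p M N p_pr (ltnW Np)); rewrite /= -ea -ea'.
    exists (i, v) => //; congr (_, _); apply: val_inj => /=.
    have [_ s1] := in_range i v; rewrite inordK //.
    by rewrite -en e addnK.
  move=> [[i' v] _ [-> ->]]; apply/existsP; exists n; apply/existsP; exists v.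
  have [r1 s1] := in_range i' v.
  by rewrite -ea eqxx inordK //= subnK.
pose G l := energy k ([set l + d | d in D] :\ 0).
have leG j : (energy k (B j) <= G (slope p L j))%N.
  case: j => i s; rewrite /G /slope /=.
  have i_neq0 : i.+1%:R != 0 :> 'F_p.
    by apply: natr_Fp_neq0 => //; exact: leq_ltn_trans (ltn_ord i) (leq_ltn_trans UN Np).
  (* Division by [u] sends [L + s + u v] to the slope plus [v]. *)
  apply: (@energy_scale _ _ (i.+1%:R)^-1); first by rewrite invr_eq0.
  move=> a; rewrite !inE => /andP[aI /existsP[n /existsP[v /andP[/eqP ea /eqP e]]]].
  apply/andP; split.
    by rewrite mulf_eq0 invr_eq0 (negPf i_neq0); apply: contraNneq I0 => <-.
  apply/imsetP; exists (v : nat)%:R; first exact: imset_f.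
  rewrite mulrC -[v%:R](mulfK i_neq0) -mulrDl; congr (_ / _).
  rewrite ea -natrM -[(v * _)%:R]/(((v * i.+1)%N%:Z)%:~R) -rmorphD /=; congr (_ %:~R).
  rewrite /= in e; rewrite /L; lia.
have natr_neq0 m : (0 < m <= k)%N -> m%:R != 0 :> 'F_p.
  move=> /andP[m_gt0 mk]; apply: natr_Fp_neq0 => //.
  by rewrite m_gt0 (leq_ltn_trans mk).
have main := energy_cover k_gt0 subB coverB leG.
have coll := card_slope_collisions R L p_pr U_gt0 UN Np NUp.
rewrite -(ler_nat R) natrM [X in _ <= X]natrM in main.
rewrite natrM (le_trans main) //; apply: ler_pM => //.
  by rewrite natrX lerXn2r ?nnegrE // (le_trans _ coll).
rewrite ler_nat; apply: leq_trans (sum_energy_translates _ _ natr_neq0) _.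
apply: leq_add.
  apply: leq_mul; last by rewrite leq_mul2l leq_exp2r ?cardD ?orbT.
  (* There are at most [U (2N + 1) <= 3NU] slopes. *)
  rewrite (leq_trans (leq_imset_card _ _)) // cardsT card_prod !card_ord.
  by rewrite mulnC mulnA leq_mul2r /S; lia.
by rewrite leq_mul2l leq_exp2r ?muln_gt0 // cardD orbT.
Qed.

(** * Choice of parameters *)

(** The bound [2^(k+1) V^k] on [N U] keeps the cost of the trivial solutions within the order of
    [V^(2k)]. It comes from the maximality of [V], and survives in the second case, where [U] does
    not grow and [V] does not drop. *)
Lemma exists_parameters (k N p : nat) : (0 < k)%N -> (0 < N < p)%N ->
  exists U V, [/\ (0 < U)%N && (0 < V)%N, (U * V <= N <= 2 * (U * V))%N,
    (N * U <= p)%N, (N * U <= 2 ^ k.+1 * V ^ k)%N &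
    (V ^ k.+1 <= N ^ 2)%N \/ (V * p <= 2 * N ^ 2)%N].
Proof.
move=> k_gt0 /andP[N_gt0 Np].
have exV : exists V, ((0 < V) && (V ^ k.+1 <= N ^ 2))%N.
  by exists 1%N; rewrite exp1n expn_gt0 N_gt0.
have ubV V : ((0 < V) && (V ^ k.+1 <= N ^ 2))%N -> (V <= N ^ 2)%N.
  by move=> /andP[V_gt0]; apply: leq_trans; rewrite -{1}[V]expn1 leq_pexp2l.
have [V /andP[V_gt0 Vk] maxV] := ex_maxnP exV ubV.
have V2k : (N ^ 2 < (2 * V) ^ k.+1)%N.
  apply: (@leq_trans (V.+1 ^ k.+1)); last by rewrite leq_exp2r // mul2n -addnn -addn1 leq_add2l.
  by rewrite ltnNge; apply/negP => h; have := maxV V.+1; rewrite h ltnn => /(_ isT).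
have VN : (V <= N)%N.
  rewrite -(leq_exp2r _ _ (ltn0Sn 1)); apply: leq_trans Vk.
  by rewrite leq_pexp2l.
have U_gt0 : (0 < N %/ V)%N by rewrite divn_gt0.
have div_ge d : (0 < d <= N)%N -> (N <= 2 * (d * (N %/ d)))%N.
  move=> /andP[d_gt0 dN]; have := ltn_ceil N d_gt0; have := leq_mul (leqnn d) (_ : 1 <= N %/ d)%N.
  by rewrite divn_gt0 // => /(_ dN); nia.
have UV : (N %/ V * V <= N)%N by exact: leq_divM.
have NU : (N * (N %/ V) <= 2 ^ k.+1 * V ^ k)%N.
  rewrite -(leq_pmul2r V_gt0) -!mulnA -expnSr -expnMn ltnW //.
  by apply: leq_ltn_trans V2k; rewrite -mulnn leq_mul2l UV orbT.
have [NUp|pNU] := leqP (N * (N %/ V)) p.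
  exists (N %/ V)%N, V; split=> //; last by left.
    by rewrite U_gt0.
  by rewrite UV [(_ * V)%N]mulnC div_ge // V_gt0.
have U'_gt0 : (0 < p %/ N)%N by rewrite divn_gt0 // ltnW.
have NU'p : (N * (p %/ N) <= p)%N by rewrite mulnC leq_divM.
have U'U : (p %/ N <= N %/ V)%N.
  by rewrite -(leq_pmul2l N_gt0) (leq_trans NU'p) // ltnW.
have U'N : (p %/ N <= N)%N by rewrite (leq_trans U'U) // leq_div.
have VV' : (V <= N %/ (p %/ N))%N.
  by rewrite leq_divRL // (leq_trans _ UV) // mulnC leq_mul2r U'U orbT.
have U'V' : (p %/ N * (N %/ (p %/ N)) <= N)%N by rewrite mulnC leq_divM.
exists (p %/ N)%N, (N %/ (p %/ N))%N; split=> //.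
- by rewrite U'_gt0 (leq_trans V_gt0).
- by rewrite U'V' div_ge // U'_gt0.
- apply: (leq_trans NU'p); apply: (leq_trans (ltnW pNU)); apply: (leq_trans NU).
  by rewrite leq_mul2l leq_exp2r // VV' orbT.
right.
(* As [p / N] is at least 1, rounding costs at most a factor 2; multiplying by [V] and using
   [V (p / N) <= N] gives [V p <= 2 N^2]. *)
have : (p <= 2 * (p %/ N) * N)%N.
  have := ltn_ceil p N_gt0 => /ltnW/leq_trans; apply.
  by rewrite leq_mul2r; apply/orP; right; lia.
move=> /(leq_mul (leqnn (N %/ (p %/ N)))) /leq_trans; apply.
rewrite -mulnn !mulnA leq_mul2r; apply/orP; right.
by rewrite mulnAC mulnC leq_mul2l /= mulnC.
Qed.

(** * Final estimates *)

(** The harmonic sum is at most [1 + ln n], and [d ln n = ln (n^d)] is at most [n^d]. *)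
Lemma harmonic_le_powR (R : realType) (d : R) (n : nat) :
  0 < d -> (0 < n)%N -> harmonic R n <= (1 + d^-1) * n%:R `^ d.
Proof.
move=> d_gt0; have log_bound m : harmonic R m.+1 <= 1 + ln m.+1%:R.
  elim: m => [|m IHm]; first by rewrite /harmonic big_nat1 invr1 ln1 addr0.
  rewrite /harmonic big_nat_recr //=.
  apply: (@le_trans _ _ (1 + ln m.+1%:R + m.+2%:R^-1)); first by rewrite lerD2r.
  rewrite -addrA lerD2l -lerBrDl.
  have m1 : 0 < m.+1%:R :> R by rewrite ltr0n.
  have m2 : 0 < m.+2%:R :> R by rewrite ltr0n.
  have inv_lt1 : m.+2%:R^-1 < 1 :> R by rewrite invf_lt1 // ltr1n.
  (* With [x = 1 / (m + 2)], [ln (1 - x) <= - x] bounds the new term by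
     [ln (m + 2) - ln (m + 1)]. *)
  have := le_ln1Dx (_ : -1 < - m.+2%:R^-1 :> R); rewrite ltrN2 => /(_ inv_lt1).
  have -> : 1 - m.+2%:R^-1 = m.+1%:R / m.+2%:R :> R.
    by rewrite -[m.+1%:R](addrK 1) natr1 mulrBl mul1r divff // gt_eqF.
  rewrite lnM ?posrE ?invr_gt0 // lnV ?posrE // => ineq.
  by rewrite -lerN2 opprB.
case: n => // n _; apply: le_trans (log_bound n) _.
have n_ge1 : 1 <= n.+1%:R :> R by rewrite ler1n.
have n_gt0 : 0 < n.+1%:R :> R by rewrite ltr0n.
have p_gt0 : 0 < n.+1%:R `^ d by exact: powR_gt0.
rewrite mulrDl mul1r; apply: lerD.
  by rewrite -[X in X <= _](powRr0 n.+1%:R) ler_powR // ltW.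
rewrite mulrC ler_pdivlMr // mulrC -ln_powR ltW //; exact: ln_sublinear.
Qed.

(** This trivial bound serves for [p <= k], where a multiplicity up to [k] may vanish in ['F_p]. *)
Lemma J2k_le_expn (p k : nat) (I : {set 'F_p}) : (J2k k I <= #|I| ^ (2 * k))%N.
Proof.
rewrite mul2n -addnn -[X in (_ ^ X)%N]card_ord -card_ffun_on.
apply/subset_leq_card/subsetP => x; rewrite inE => /andP[/forallP xI _].
exact/ffun_onP.
Qed.

(** Replacing [U V] by [N / 2] on the left costs [2^(2k)]; the bound on [N U] reduces the last
    factor to a multiple of [V^(2k)], and [(N U)^(2k-1) V^(2k) = (N U V)^(2k-1) V <= N^(4k-2) V]. *)
Lemma energy_le_of_parameters (R : realFieldType) (k N U V J : nat) (h : R) :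
  (0 < k)%N -> (0 < N)%N -> 0 <= h ->
  (U * V <= N <= 2 * (U * V))%N -> (N * U <= 2 ^ k.+1 * V ^ k)%N ->
  ((U * V) ^ (2 * k) * J)%:R <= (32%:R * (N * U)%:R * h ^+ 2) ^+ (2 * k).-1 *
    (3 * (N * U) * (k ^ k * V ^ k) + 2 * k * V ^ (2 * k))%:R ->
  J%:R <= (2 ^ (2 * k) * 32 ^ (2 * k).-1 * (3 * 2 ^ k.+1 * k ^ k + 2 * k))%:R *
    h ^+ (2 * (2 * k).-1) * (N ^ (2 * k - 2) * V)%:R.
Proof.
move=> k_gt0 N_gt0 h_ge0 /andP[UVN NUV] NUVk.
set m := (2 * k).-1; set K := (3 * 2 ^ k.+1 * k ^ k + 2 * k)%N.
have em : (2 * k = m.+1)%N by rewrite prednK // muln_gt0.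
have le_K : (3 * (N * U) * (k ^ k * V ^ k) + 2 * k * V ^ (2 * k) <= K * V ^ (2 * k))%N.
  rewrite /K mulnDl leq_add2r mul2n -addnn expnD.
  rewrite [leqRHS](_ : _ = 3 * (2 ^ k.+1 * V ^ k) * (k ^ k * V ^ k))%N; last by ring.
  by rewrite leq_mul2r leq_mul2l NUVk !orbT.
have le_NUV : ((N * U) ^ m * V ^ (2 * k) <= N ^ (2 * k) * (N ^ (2 * k - 2) * V))%N.
  rewrite mulnA -expnD em expnSr mulnA -expnMn leq_mul2r -mulnA.
  apply/orP; right; apply: (@leq_trans ((N * N) ^ m)).
    by rewrite leq_exp2r ?leq_mul2l ?UVN ?orbT // /m; lia.
  by rewrite mulnn -expnM leq_pexp2l // /m; lia.
move=> main.
have N2k_gt0 : 0 < (N ^ (2 * k))%:R :> R by rewrite ltr0n expn_gt0 N_gt0.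
rewrite -(ler_pM2l N2k_gt0) -natrM.
apply: (@le_trans _ _ ((2 ^ (2 * k))%:R * ((U * V) ^ (2 * k) * J)%:R)).
  by rewrite -natrM ler_nat mulnA -expnMn leq_mul2r leq_exp2r ?muln_gt0 ?NUV ?orbT.
apply: (@le_trans _ _ ((2 ^ (2 * k))%:R *
    ((32%:R * (N * U)%:R * h ^+ 2) ^+ m * (K * V ^ (2 * k))%:R))).
  apply: ler_wpM2l => //; apply: (le_trans main); apply: ler_wpM2l; last by rewrite ler_nat.
  by rewrite exprn_ge0 // !mulr_ge0 ?exprn_ge0.
have -> : (2 ^ (2 * k))%:R * ((32%:R * (N * U)%:R * h ^+ 2) ^+ m * (K * V ^ (2 * k))%:R)
    = (2 ^ (2 * k) * 32 ^ m * K)%:R * h ^+ (2 * m) * ((N * U) ^ m * V ^ (2 * k))%:R.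
  rewrite exprM !exprMn -!natrX !(natrM R) !natrX; ring.
rewrite [leRHS]mulrCA -natrM; apply: ler_wpM2l; last by rewrite ler_nat.
by rewrite mulr_ge0 ?exprn_ge0.
Qed.

(** This form separates the factor [N^(2k-2)], so that only [V <= N^(2/(k+1))] remains to be
    checked. *)
Lemma exponent_split (R : numFieldType) (k : nat) : (0 < k)%N ->
  (2 * k ^ 2)%:R / (k + 1)%:R = (2 * k - 2)%:R + 2%:R / (k + 1)%:R :> R.
Proof.
move=> k_gt0; have k1 : (k + 1)%:R != 0 :> R by rewrite pnatr_eq0 addn1.
apply: (mulIf k1); rewrite mulrDl !divfK // -natrM -natrD; congr _%:R.
by case: k k_gt0 {k1} => // k _; lia.
Qed.

Theorem theorem1 (R : realType) (k : nat) (hk : (0 < k)%N)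
    (eps : R) (heps : 0 < eps) :
  exists c : R, 0 < c /\
    forall (p : nat) (I : {set 'F_p}),
      prime p -> Fp_interval I -> 0 \notin I ->
      (J2k k I)%:R <
        c * (#|I|%:R `^ ((2 * k ^ 2)%:R / (k + 1)%:R)
             + #|I|%:R ^+ (2 * k) / p%:R)
          * #|I|%:R `^ eps.
Proof.
(* [e] is the power of the harmonic sum in the bound, and [d = eps / e] makes [(N^d)^e = N^eps]. *)
pose e := (2 * (2 * k).-1)%N; pose d : R := eps / e%:R.
have e_gt0 : (0 < e)%N by rewrite /e; lia.
have d_gt0 : 0 < d by rewrite divr_gt0 ?ltr0n.
pose A := (2 ^ (2 * k) * 32 ^ (2 * k).-1 * (3 * 2 ^ k.+1 * k ^ k + 2 * k))%N.
pose C : R := (1 + d^-1) ^+ e.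
have C_ge0 : 0 <= C by rewrite exprn_ge0 // addr_ge0 // invr_ge0 ltW.
have AC_ge0 : 0 <= A%:R * C * 2%:R by rewrite !mulr_ge0.
(* The first term serves for [p > k], the term [k] for [p <= k], and 1 makes the inequality
   strict. *)
exists (A%:R * C * 2%:R + k%:R + 1); split.
  by rewrite ltr_wpDl // addr_ge0.
move=> p I p_pr [M [N [/andP[N_gt0 N_le] defI]]] I0.
have cardI : #|I| = N.
  by rewrite defI card_imset ?cardsT ?card_ord //; exact: intr_Fp_inj.
have Np : (N < p)%N.
  rewrite -cardI -[X in (_ < X)%N](card_Fp p_pr) -cardsT proper_card // properE subsetT /=.
  by apply/subsetPn; exists 0.
rewrite cardI.
have p_gt0 : 0 < p%:R :> R by rewrite ltr0n prime_gt0.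
have N_gt0' : 0 < N%:R :> R by rewrite ltr0n.
have N_ge1 : 1 <= N%:R :> R by rewrite ler1n.
set X := _ `^ _ + _; set Y := _ `^ eps.
have Y_ge1 : 1 <= Y by rewrite -[X in X <= _](powRr0 N%:R) ler_powR // ltW.
have Y_gt0 : 0 < Y by apply: lt_le_trans Y_ge1.
have X1_gt0 : 0 < N%:R `^ ((2 * k ^ 2)%:R / (k + 1)%:R) :> R by exact: powR_gt0.
have X2_ge0 : 0 <= N%:R ^+ (2 * k) / p%:R :> R by rewrite divr_ge0 // exprn_ge0.
have X_gt0 : 0 < X by exact: ltr_wpDr.
have XY_gt0 : 0 < X * Y by rewrite mulr_gt0.
rewrite -mulrA mulrDl mul1r; apply: (@le_lt_trans _ _ ((A%:R * C * 2%:R + k%:R) * (X * Y))).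
  (* For [p <= k] the second term of [X] suffices: [N^(2k) = p (N^(2k) / p) <= k X]. *)
  have [pk|kp] := leqP p k.
    apply: (@le_trans _ _ (k%:R * (X * Y))); last first.
      by rewrite ler_pM2r // lerDr.
    apply: (@le_trans _ _ (p%:R * (X * Y))); last by rewrite ler_pM2r // ler_nat.
    apply: (@le_trans _ _ (N%:R ^+ (2 * k))).
      by rewrite -natrX ler_nat -cardI J2k_le_expn.
    rewrite mulrC -ler_pdivrMr //; apply: (@le_trans _ _ X); first by rewrite lerDr ltW.
    by rewrite ler_peMr // ltW.
  have NNp : (0 < N < p)%N by rewrite N_gt0.
  have [U [V [/andP[U_gt0 V_gt0] UVN NUp NUVk Vbd]]] := exists_parameters hk NNp.
  have kp' : (0 < k < p)%N by rewrite hk.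
  have UVN1 : (U * V <= N)%N by case/andP: UVN.
  have main := energy_interval_bound R p_pr kp' U_gt0 V_gt0 UVN1 Np NUp defI I0.
  have h_ge0 : 0 <= harmonic R U by apply: le_trans (harmonic_ge1 R U_gt0).
  have {main} := energy_le_of_parameters hk N_gt0 h_ge0 UVN NUVk main.
  rewrite -/A -/e => main.
  have hY : harmonic R U ^+ e <= C * Y.
    have UN : (U <= N)%N by apply: leq_trans UVN1; rewrite leq_pmulr.
    have -> : C * Y = ((1 + d^-1) * N%:R `^ d) ^+ e.
      rewrite exprMn -[_ `^ _ ^+ _]powR_mulrn ?powR_ge0 // -powRrM /d divfK //.
      by rewrite pnatr_eq0 -lt0n.
    rewrite lerXn2r ?nnegrE //.
      by rewrite mulr_ge0 ?powR_ge0 // addr_ge0 // invr_ge0 ltW.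
    exact: le_trans (le_harmonic R UN) (harmonic_le_powR d_gt0 N_gt0).
  have VX : (N ^ (2 * k - 2) * V)%:R <= 2%:R * X.
    (* The two alternatives for [V] lead to the first and the second term of [X]. *)
    rewrite natrM natrX; case: Vbd => [Vk|Vp].
      apply: (@le_trans _ _ (N%:R `^ ((2 * k ^ 2)%:R / (k + 1)%:R))); last first.
        apply: (@le_trans _ _ X); first by rewrite lerDl.
        by rewrite ler_peMl ?ler1n // ltW.
      rewrite exponent_split //.
      rewrite powRD; last by rewrite (gt_eqF N_gt0') implybT.
      rewrite powR_mulrn // ler_pM2l ?exprn_gt0 //.
      rewrite powRrM powR_mulrn // -natrX.
      apply: (@le_trans _ _ ((V ^ k.+1)%:R `^ (k + 1)%:R^-1)); last first.
        by rewrite ge0_ler_powR ?nnegrE ?invr_ge0 // ler_nat.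
      by rewrite natrX -powR_mulrn // -powRrM addn1 divff ?powRr1 // pnatr_eq0.
    apply: (@le_trans _ _ (2%:R * (N%:R ^+ (2 * k) / p%:R))); last first.
      by rewrite ler_pM2l // lerDr ltW.
    have -> : N%:R ^+ (2 * k) = N%:R ^+ (2 * k - 2) * N%:R ^+ 2 :> R.
      by rewrite -exprD subnK // leq_pmulr.
    rewrite -[_ * _ / _]mulrA [2%:R * _]mulrCA ler_pM2l ?exprn_gt0 //.
    by rewrite mulrA ler_pdivlMr // -natrX -!natrM ler_nat.
  apply: (@le_trans _ _ (A%:R * C * 2%:R * (X * Y))); last first.
    by rewrite ler_pM2r // lerDl.
  apply: (@le_trans _ _ (energy k I)%:R); first by rewrite ler_nat J2k_le_energy.
  apply: (le_trans main).
  have -> : A%:R * C * 2%:R * (X * Y) = A%:R * (C * Y) * (2%:R * X) by ring.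
  by apply: ler_pM => //; [rewrite mulr_ge0 // exprn_ge0 | rewrite ler_wpM2l].
by rewrite ltrDl.
Qed.
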